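(* Let $m,s,t,n$ be positive integers with $n\geq m\geq 3$. Then $$tn(m+s-2)+s\leq r(K_{m}, sF_{t,n})\leq (tn+1)(s-1)+r(K_{m},F_{t,n}).$$
   Context: For graphs $G,H$, the Ramsey number $r(G,H)$ is the least integer $r$ such that every red/blue edge-coloring of the complete graph $K_r$ contains a red copy of $G$ or a blue copy of $H$. The generalized fan $F_{t,n}$ is $K_1+nK_t$, the join of a single vertex with the disjoint union of $n$ copies of $K_t$. For a graph $G$ and positive integer $s$, $sG$ denotes the disjoint union of $s$ copies of $G$. *)

(* Defs.v *)
From mathcomp Require Import all_boot.

Set Implicit Arguments.
Unset Strict Implicit.
Unset Printing Implicit Defensive.

Record sgraph := SGraph {
  vertex :> finType;
  adj : rel vertex;
  adj_sym : symmetric adj;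
  adj_irr : irreflexive adj }.

Lemma neq_sym (T : eqType) : symmetric (fun x y : T => x != y).
Proof. by move=> x y; rewrite eq_sym. Qed.

Lemma neq_irr (T : eqType) : irreflexive (fun x y : T => x != y).
Proof. by move=> x; rewrite eqxx. Qed.

Definition complete (n : nat) : sgraph :=
  SGraph (@neq_sym 'I_n) (@neq_irr 'I_n).

Definition copies_adj (G : sgraph) (s : nat) : rel ('I_s * G)%type :=
  fun u v => (u.1 == v.1) && adj u.2 v.2.

Lemma copies_sym G s : symmetric (@copies_adj G s).
Proof. by move=> u v; rewrite /copies_adj eq_sym adj_sym. Qed.

Lemma copies_irr G s : irreflexive (@copies_adj G s).
Proof. by move=> u; rewrite /copies_adj adj_irr andbF. Qed.

Definition copies (G : sgraph) (s : nat) : sgraph :=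
  SGraph (@copies_sym G s) (@copies_irr G s).

Definition join_adj (G H : sgraph) : rel (G + H)%type := fun u v =>
  match u, v with
  | inl x, inl y => adj x y
  | inr x, inr y => adj x y
  | _, _ => true
  end.

Lemma join_sym G H : symmetric (@join_adj G H).
Proof. by move=> [x|x] [y|y] //=; rewrite adj_sym. Qed.

Lemma join_irr G H : irreflexive (@join_adj G H).
Proof. by move=> [x|x] /=; rewrite adj_irr. Qed.

Definition join (G H : sgraph) : sgraph :=
  SGraph (@join_sym G H) (@join_irr G H).

Definition fan (t n : nat) : sgraph :=
  join (complete 1) (copies (complete t) n).

(* Edges of K_r are the two-element subsets of 'I_r; true is red and false is
   blue. Values of a colouring on subsets of any other cardinality are never
   inspected: an adjacency-preserving injection maps edges to 2-subsets. *)
Definition coloring (r : nat) := {ffun {set 'I_r} -> bool}.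

(* Copies are subgraphs, not necessarily induced. *)
Definition mono_copy (r : nat) (c : coloring r) (b : bool) (G : sgraph) : bool :=
  [exists f : {ffun G -> 'I_r}, injectiveb f &&
    [forall x, forall y, adj x y ==> (c [set f x; f y] == b)]].

Definition arrows (G H : sgraph) (r : nat) : bool :=
  [forall c : coloring r, mono_copy c true G || mono_copy c false H].

Definition clique (T : finType) (c : {set T} -> bool) (b : bool) (S : {set T}) :=
  forall x y, x \in S -> y \in S -> x != y -> c [set x; y] = b.

Lemma clique_extend (T : finType) (c : {set T} -> bool) b x (S : {set T}) :
  clique c b S -> {in S, forall y, c [set x; y] = b} -> clique c b (x |: S).
Proof.
move=> clS xS y z /setU1P[->|yS] /setU1P[->|zS] ne; last exact: clS.
- by rewrite eqxx in ne.
- exact: xS.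
- by rewrite setUC; apply: xS.
Qed.

Lemma ramsey_clique (T : finType) (c : {set T} -> bool) n :
  forall a b (A : {set T}), a + b <= n -> 2 ^ n <= #|A| ->
  (exists S : {set T}, [/\ S \subset A, #|S| = a & clique c true S]) \/
  (exists S : {set T}, [/\ S \subset A, #|S| = b & clique c false S]).
Proof.
have cl0 d : clique c d set0 by move=> x y; rewrite inE.
elim: n => [|n IH] [|a] [|b] A // leabn leA.
- by left; exists set0; rewrite sub0set cards0.
- by left; exists set0; rewrite sub0set cards0.
- by left; exists set0; rewrite sub0set cards0.
- by right; exists set0; rewrite sub0set cards0.
have /card_gt0P[x xA] : 0 < #|A| by apply: leq_trans leA; rewrite expn_gt0.
pose N (d : bool) := [set y in A :\ x | c [set x; y] == d].
have NA d : N d \subset A :\ x by apply/subsetP=> y; rewrite inE => /andP[].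
have cardN : #|A| = (#|N true| + #|N false|).+1.
  rewrite (cardsD1 x) xA -(cardsID [set y | c [set x; y]] (A :\ x)) add1n.
  congr (_ + _).+1; apply: eq_card => y; rewrite !inE.
  - by rewrite eqb_id.
  - by rewrite eqbF_neg andbC.
have ext d (S : {set T}) : S \subset N d -> clique c d S ->
    [/\ x |: S \subset A, #|x |: S| = #|S|.+1 & clique c d (x |: S)].
  move=> SN clS; have SA := subset_trans SN (NA d); split.
  - by rewrite subUset sub1set xA (subset_trans SA) ?subsetDl.
  - rewrite cardsU1; case: (boolP (x \in S)) => // /(subsetP SA).
    by rewrite !inE eqxx.
  - apply: clique_extend => // y /(subsetP SN).
    by rewrite inE => /andP[_ /eqP].
have NsubA d (S : {set T}) : S \subset N d -> S \subset A.
  by move=> SN; rewrite (subset_trans (subset_trans SN (NA d))) ?subsetDl.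
case: (leqP (2 ^ n) #|N true|) => [leN|ltN].
  have leab : a + b.+1 <= n by rewrite -ltnS -addSn.
  case: (IH a b.+1 (N true) leab leN) => -[S [SN cS clS]].
    by left; exists (x |: S); have [? -> ?] := ext _ _ SN clS; rewrite cS.
  by right; exists S; split=> //; apply: NsubA SN.
have leN : 2 ^ n <= #|N false|.
  rewrite leqNgt; apply/negP => ltF; move: leA.
  by rewrite cardN expnS mul2n -addnn leqNgt -addSn -addnS leq_add.
have leab : a.+1 + b <= n by rewrite -ltnS -addnS.
case: (IH a.+1 b (N false) leab leN) => -[S [SN cS clS]].
  by left; exists S; split=> //; apply: NsubA SN.
by right; exists (x |: S); have [? -> ?] := ext _ _ SN clS; rewrite cS.
Qed.

Lemma mono_copy_clique r (c : coloring r) b (G : sgraph) (S : {set 'I_r}) :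
  #|S| = #|G| -> clique c b S -> mono_copy c b G.
Proof.
move=> cS clS; apply/existsP.
pose g (x : G) := enum_val (cast_ord (esym cS) (enum_rank x)).
have ginj : injective g.
  by move=> x y /enum_val_inj/cast_ord_inj/enum_rank_inj.
exists (finfun g); apply/andP; split.
  by apply/injectiveP => x y; rewrite !ffunE => /ginj.
apply/forallP => x; apply/forallP => y; apply/implyP => xy.
rewrite !ffunE clS ?enum_valP // (inj_eq ginj).
by apply: contraTneq xy => ->; rewrite adj_irr.
Qed.

Theorem ramsey_exists (G H : sgraph) : exists r, arrows G H r.
Proof.
exists (2 ^ (#|G| + #|H|)); apply/forallP => c.
have := @ramsey_clique _ c _ #|G| #|H| setT (leqnn _).
rewrite cardsT card_ord => /(_ (leqnn _)) [] [S [_ cS clS]].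
- by rewrite (mono_copy_clique cS clS).
- by rewrite (mono_copy_clique cS clS) orbT.
Qed.

Definition ramsey (G H : sgraph) : nat := ex_minn (ramsey_exists G H).

(* Main.v *)
Require Import Defs.
From mathcomp Require Import all_boot.
From mathcomp Require Import zify.

Set Implicit Arguments.
Unset Strict Implicit.
Unset Printing Implicit Defensive.

(** Upper bound: greedily remove vertex-disjoint blue copies of the fan; before
    the last removal there are still [r(K_m, F)] vertices left.

    Lower bound: with [k = tn], colour blue the edges inside the parts of a
    partition into [m - 2] parts of size [k] and one part of size
    [s (k + 1) - 1], and red the others.  A red clique meets each of the
    [m - 1] parts at most once; a blue fan, being connected with [k + 1]
    vertices, lies in the big part, which is one vertex too small for [s]
    disjoint fans. *)

(** Confining a copy to a subset [A] of any finite type lets the greedy removal recurse on what is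
    left without relabelling vertices. *)
Definition embeds_in {T : finType} (c : {set T} -> bool) b (G : sgraph)
    (A : {set T}) : Prop :=
  exists f : G -> T, [/\ injective f, forall x, f x \in A &
    forall x y, adj x y -> c [set f x; f y] = b].

Lemma mono_copyP r (c : coloring r) b (G : sgraph) :
  reflect (embeds_in c b G setT) (mono_copy c b G).
Proof.
apply: (iffP existsP) => [[f /andP[/injectiveP finj /forallP fadj]]|].
  exists f; split=> // x y xy.
  by have /forallP/(_ y)/implyP/(_ xy)/eqP := fadj x.
case=> f [finj _ fadj]; exists (finfun f); apply/andP; split.
  by apply/injectiveP => x y; rewrite !ffunE => /finj.
apply/forallP => x; apply/forallP => y; apply/implyP => xy.
by rewrite !ffunE fadj.
Qed.

(** The colouring is pulled back along an injection of ['I_r] into [A], and the copy found there is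
    pushed forward. *)
Lemma arrows_embeds (G H : sgraph) r (T : finType) (c : {set T} -> bool)
    (A : {set T}) :
  arrows G H r -> r <= #|A| -> embeds_in c true G A \/ embeds_in c false H A.
Proof.
move=> /forallP GHr ler.
pose e (i : 'I_r) : T := enum_val (widen_ord ler i).
have einj : injective e.
  by move=> i j /enum_val_inj/(congr1 val)/= /val_inj.
pose c' : coloring r := [ffun S : {set 'I_r} => c (e @: S)].
have transfer b K : mono_copy c' b K -> embeds_in c b K A.
  move=> /mono_copyP[f [finj _ fadj]]; exists (e \o f); split.
  - exact: inj_comp.
  - by move=> x; apply: enum_valP.
  - by move=> x y /fadj; rewrite ffunE imsetU1 imset_set1.
by case/orP: (GHr c') => /transfer; [left|right].
Qed.

Lemma arrows_leq (G H : sgraph) r r' : r <= r' -> arrows G H r -> arrows G H r'.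
Proof.
move=> ler GHr; apply/forallP => c.
have ler' : r <= #|[set: 'I_r']| by rewrite cardsT card_ord.
case: (arrows_embeds c GHr ler') => /mono_copyP -> //.
by rewrite orbT.
Qed.

Lemma ramsey_arrows (G H : sgraph) : arrows G H (ramsey G H).
Proof. by rewrite /ramsey; case: ex_minnP. Qed.

Lemma ramsey_leq (G H : sgraph) r : arrows G H r -> ramsey G H <= r.
Proof. by rewrite /ramsey; case: ex_minnP => r0 _; apply. Qed.

(** By monotonicity of [arrows], one bad colouring on [r] vertices also excludes every smaller
    number. *)
Lemma ltn_ramsey (G H : sgraph) r : ~~ arrows G H r -> r < ramsey G H.
Proof.
by apply: contraNltn => /arrows_leq; apply; apply: ramsey_arrows.
Qed.

Lemma arrows_embeds_copies (G H : sgraph) r (T : finType)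
    (c : {set T} -> bool) s (A : {set T}) :
  arrows G H r -> #|H| * s + r <= #|A| ->
  embeds_in c true G A \/ embeds_in c false (copies H s.+1) A.
Proof.
move=> GHr; elim: s A => [|s IH] A leA.
  have leA' : r <= #|A| by rewrite muln0 in leA.
  case: (arrows_embeds c GHr leA') => [|[f [finj fA fadj]]]; first by left.
  right; exists (fun u => f u.2); split=> //.
  - by move=> [i x] [j y] /= /finj ->; rewrite (ord1 i) (ord1 j).
  - by move=> [i x] [j y] /andP[_ /fadj].
have leA' : r <= #|A| by apply: leq_trans leA; apply: leq_addl.
case: (arrows_embeds c GHr leA') => [|[f [finj fA fadj]]]; first by left.
pose B := [set f x | x in [set: H]].
have cB : #|B| = #|H| by rewrite card_imset // cardsT.
have BA : B \subset A by apply/subsetP => _ /imsetP[x _ ->].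
have fB x : f x \in B by apply: imset_f; rewrite inE.
have leD : #|H| * s + r <= #|A :\: B|.
  by rewrite cardsD (setIidPr BA) cB; move: leA; rewrite mulnS; lia.
case: (IH _ leD) => [[g [ginj gA gadj]]|[g [ginj gA gadj]]].
  left; exists g; split=> // x.
  by have := gA x; rewrite inE => /andP[].
have gB u : g u \notin B by have := gA u; rewrite inE => /andP[].
(* Index [ord0] gets the removed copy [f]; the other indices get the copies [g] found outside its
   image [B]. *)
pose h (u : copies H s.+2) : T :=
  if unlift ord0 u.1 is Some j then g (j, u.2) else f u.2.
right; exists h; split.
- move=> [i x] [j y]; rewrite /h /=.
  case: unliftP => [i'|] ->; case: unliftP => [j'|] -> /=.
  + by move=> /ginj[-> ->].
  + by move=> gf; have := gB (i', x); rewrite gf fB.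
  + by move=> fg; have := gB (j', y); rewrite -fg fB.
  + by move=> /finj ->.
- move=> [i x]; rewrite /h /=; case: unliftP => [i'|] _ //.
  by have := gA (i', x); rewrite inE => /andP[].
- move=> [i x] [j y] /andP[/= /eqP-> xy]; rewrite /h /=.
  case: unliftP => [j'|] _; last exact: fadj.
  by apply: gadj; apply/andP; split=> /=.
Qed.

Lemma ramsey_copies_leq (G H : sgraph) s :
  ramsey G (copies H s.+1) <= #|H| * s + ramsey G H.
Proof.
apply: ramsey_leq; apply/forallP => c.
have le : #|H| * s + ramsey G H <= #|[set: 'I_(#|H| * s + ramsey G H)]|.
  by rewrite cardsT card_ord.
case: (arrows_embeds_copies c (ramsey_arrows G H) le) => /mono_copyP -> //.
by rewrite orbT.
Qed.

(** Pigeonhole, applied below to part indices, to residues modulo [k] and to shifted vertices. *)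
Lemma leq_card_bounded (T : finType) (g : T -> nat) n :
  injective g -> (forall x, g x < n) -> #|T| <= n.
Proof.
move=> ginj gn; rewrite -[n]card_ord.
apply: (@leq_card _ _ (fun x => Ordinal (gn x))) => x y.
by move=> /(congr1 val) /ginj.
Qed.

Definition multipartite_coloring {r} (p : 'I_r -> nat) : coloring r :=
  [ffun S : {set 'I_r} => [exists x in S, exists y in S, p x != p y]].

Lemma multipartite_coloringE r (p : 'I_r -> nat) x y :
  multipartite_coloring p [set x; y] = (p x != p y).
Proof.
rewrite ffunE; apply/existsP/idP => [[u /andP[uS /existsP[v /andP[vS]]]]|ne].
  move: uS vS; rewrite !inE.
  by case/orP=> /eqP->; case/orP=> /eqP->; rewrite ?eqxx // eq_sym.
exists x; rewrite !inE eqxx /=; apply/existsP; exists y.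
by rewrite !inE eqxx orbT.
Qed.

(** A fan enters only through its order [k.+1] and its hub [h]; [m] counts the small parts. *)
Lemma ramsey_copies_gt (m s k : nat) (H : sgraph) (h : H) :
  0 < k -> 0 < s -> #|H| = k.+1 -> (forall x, x != h -> adj h x) ->
  k * m + s * k.+1 <= ramsey (complete m.+2) (copies H s).
Proof.
move=> k0 s0 cH hdom.
have sk0 : 0 < s * k.+1 by rewrite muln_gt0 s0.
pose N := k * m + (s * k.+1).-1.
have -> : k * m + s * k.+1 = N.+1 by rewrite /N; lia.
apply: ltn_ramsey; apply/forallPn.
(* Small parts are blocks of [k] consecutive integers; [minn] merges everything from [k * m] on into
   part [m]. *)
pose p (v : 'I_N) := minn (v %/ k) m.
exists (multipartite_coloring p); rewrite negb_or; apply/andP; split.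
  apply/mono_copyP => -[f [_ _ fadj]].
  have pinj : injective (fun x => p (f x)).
    move=> x y pxy; apply/eqP; apply: contraT => ne.
    by have := fadj x y ne; rewrite multipartite_coloringE pxy eqxx.
  have plt x : p (f x) < m.+1 by rewrite ltnS geq_minr.
  by have := leq_card_bounded pinj plt; rewrite card_ord ltnn.
apply/mono_copyP => -[f [finj _ fadj]].
(* Blue edges stay inside a part, so each copy lies in the part of its hub. *)
have phub i x : p (f (i, x)) = p (f (i, h)).
  have [-> //|ne] := eqVneq x h.
  have /fadj : @adj (copies H s) (i, h) (i, x) by rewrite /= /copies_adj eqxx hdom.
  by rewrite multipartite_coloringE => /negbFE/eqP.
have big i : m <= f (i, h) %/ k.
  rewrite leqNgt; apply/negP => lt.
  (* In a small part the quotient is constant, so remainders would inject [k.+1] vertices into [k]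
     residues. *)
  have divf x : f (i, x) %/ k = f (i, h) %/ k.
    by have := phub i x; rewrite /p; lia.
  have ginj : injective (fun x : H => f (i, x) %% k).
    move=> x y xy; suff [] : (i, x) = (i, y) by [].
    apply: finj; apply: val_inj => /=.
    by rewrite (divn_eq (f (i, x)) k) xy !divf -(divf y) -divn_eq.
  have := leq_card_bounded ginj (fun x => ltn_pmod _ k0).
  by rewrite cH ltnn.
have bigf u : k * m <= f u.
  case: u => i x; have := phub i x; have := big i; rewrite /p => b e.
  have le : m <= f (i, x) %/ k by lia.
  by rewrite mulnC -leq_divRL.
have ginj : injective (fun u => f u - k * m).
  move=> u v uv; apply: finj; apply: val_inj => /=.
  by have := bigf u; have := bigf v; lia.
have glt u : f u - k * m < (s * k.+1).-1.
  by have := bigf u; have := ltn_ord (f u); rewrite {2}/N; lia.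
by have := leq_card_bounded ginj glt; rewrite card_prod card_ord cH; lia.
Qed.

Lemma card_fan t n : #|fan t n| = (t * n).+1.
Proof. by rewrite card_sum card_prod !card_ord add1n mulnC. Qed.

Theorem theorem1p7 (m s t n : nat)
    (hs : 0 < s) (ht : 0 < t) (hm : 3 <= m) (hmn : m <= n) :
  t * n * (m + s - 2) + s <= ramsey (complete m) (copies (fan t n) s) /\
  ramsey (complete m) (copies (fan t n) s)
    <= (t * n + 1) * (s - 1) + ramsey (complete m) (fan t n).
Proof.
split; last first.
  case: s hs => // s _.
  by rewrite subn1 addn1 -card_fan; apply: ramsey_copies_leq.
case: m hm hmn => [|[|m]] // _ hmn.
have k0 : 0 < t * n by rewrite muln_gt0 ht; apply: leq_trans hmn.
have hdom (x : fan t n) : x != inl ord0 -> adj (inl ord0 : fan t n) x.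
  by case: x => // i; rewrite (ord1 i) eqxx.
have := @ramsey_copies_gt m s (t * n) (fan t n) (inl ord0) k0 hs (card_fan t n) hdom.
(* With [m] now standing for the original value minus 2, the two lower bounds are equal. *)
apply: leq_trans; rewrite mulnS; nia.
Qed.
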